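(* Let $1 \le s \le r$ be fixed integers and let $n \ge r$. Let $H_1, H_2, \ldots$ be independent, each uniformly distributed over the $r$-element subsets of $[n] = \{1, \ldots, n\}$. An $s$-element subset $S \subseteq [n]$ is said to be collected by time $k$ if $S \subseteq H_t$ for some $t \le k$. Let $T^{(r,s)}$ be the smallest $k$ such that all $\binom{n}{s}$ $s$-element subsets of $[n]$ have been collected by time $k$. Then, as $n \to \infty$ (with $r, s$ fixed), \[ \mathbb{E}\, T^{(r,s)} = \frac{\binom{n}{s}\log\binom{n}{s}}{\binom{r}{s}}\,(1+o(1)). \]
   Context: In each round $t$ one draws $r$ distinct coupons uniformly at random (without replacement) from the universe $[n]$, independently across rounds; all $\binom{r}{s}$ $s$-subsets (''super-coupons'') of the drawn $r$-set are then marked as collected. *)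

(* Defs.v *)
From HB Require Import structures.
From mathcomp Require Import all_boot all_order all_algebra.
From mathcomp Require Import all_classical all_reals all_analysis.
Set Implicit Arguments. Unset Strict Implicit. Unset Printing Implicit Defensive.
Import Order.TTheory GRing.Theory Num.Theory.
Local Open Scope ring_scope.

Definition rset (n r : nat) (H : {set 'I_n}) : bool := #|H| == r.

Definition covers (n s : nat) (hs : seq {set 'I_n}) : bool :=
  [forall S : {set 'I_n}, (#|S| == s) ==> has (fun H : {set 'I_n} => (S \subset H)%SET) hs].

Definition T_eq (n s k : nat) (hs : seq {set 'I_n}) : bool :=
  covers s (take k hs) && ((k == 0)%N || ~~ covers s (take k.-1 hs)).

(* P(T = k): (H_1,...,H_k) is uniform on k-tuples of r-subsets of 'I_n
   (independent uniform draws). *)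
Definition PT (R : realType) (n r s k : nat) : R :=
  #|[set hs : k.-tuple {set 'I_n} | all (rset r) hs && T_eq s k hs]|%:R /
  #|[set hs : k.-tuple {set 'I_n} | all (rset r) hs]|%:R.

Definition ET (R : realType) (n r s : nat) : \bar R :=
  (\sum_(0 <= k <oo) ((k%:R * PT R n r s k)%:E))%E.

Definition mainterm (R : realType) (n r s : nat) : R :=
  'C(n, s)%:R * ln ('C(n, s)%:R : R) / 'C(r, s)%:R.

(* Main.v *)
(** Let N = 'C(n, s), m = 'C(r, s), p = m / N, and let U_k be the number of
    s-sets still uncollected after k rounds.  Each s-set lies in a random r-set
    with probability p, so a round collects on average u p new s-sets when
    U_k = u, and never more than m.  When u drops to u - d, the potential
    ln (1 + u / m) drops by at most d / u (because d <= m), while the potential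
    equal to 1 + ln u for u > 0 and to 0 for u = 0 drops by at least d / u.
    Hence, as long as U_k > 0, one expected step lowers the first by at most p
    and the second by at least p; summing over the steps gives
      ln (1 + N / m) <= p E[T] <= 1 + ln N,
    and the claim follows from ln N -> +oo. *)
Require Import Defs.
From HB Require Import structures.
From mathcomp Require Import all_boot all_order all_algebra.
From mathcomp Require Import all_classical all_reals all_analysis.
From mathcomp Require Import ring lra zify.
Import Order.TTheory GRing.Theory Num.Theory.
Local Open Scope ring_scope.
Import numFieldNormedType.Exports.

(** * Counting [r]-sets that contain a given [s]-set *)

(** Complementation turns the supersets of [S] of size [r] into the subsets of [~: S] of size
    [#|T| - r]. *)
Lemma card_supersets (T : finType) (S : {set T}) (r : nat) :
  (#|S| <= r <= #|T|)%N ->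
  #|[set H : {set T} | (S \subset H) && (#|H| == r)]| =
  'C(#|T| - #|S|, r - #|S|).
Proof.
case/andP=> hSr hrT.
have cC (A : {set T}) : #|~: A| = (#|T| - #|A|)%N.
  by rewrite cardsCs finset.setCK.
rewrite -bin_sub ?leq_sub2r //.
have -> : (#|T| - #|S| - (r - #|S|) = #|T| - r)%N.
  by rewrite subnBA // subnK // (leq_trans hSr).
rewrite -cC -(cards_draws (~: S)) -(card_imset _ (@finset.setC_inj T)).
congr #|pred_of_set _|; apply/finset.setP=> A; rewrite inE; apply/imsetP/idP.
- case=> H; rewrite inE => /andP[SH /eqP <-] ->.
  by rewrite finset.setCS SH /= cC.
- case/andP=> AS /eqP cA; exists (~: A); last by rewrite finset.setCK.
  by rewrite inE finset.subsetC AS /= cC cA subKn.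
Qed.

(** Double counting of the pairs [S \subset H]: after the sums are exchanged, every [S] in [U]
    contributes the same number of [H]. This yields the mean number of new [s]-sets in a round. *)
Lemma sum_subsets_covered (n r s : nat) (U : {set {set 'I_n}}) :
  (s <= r <= n)%N -> {in U, forall S : {set 'I_n}, #|S| = s} ->
  (\sum_(H : {set 'I_n} | rset r H) #|[set S in U | S \subset H]| =
   #|U| * 'C(n - s, r - s))%N.
Proof.
move=> hsrn hU.
under eq_bigr do rewrite -sum1dep_card.
rewrite (exchange_big_dep (mem U)) /=; last by move=> H S _ /andP[].
rewrite (eq_bigr (fun=> 'C(n - s, r - s))) ?sum_nat_const // => S SU.
have cS := hU _ SU.
have := @card_supersets _ S r; rewrite card_ord cS => /(_ hsrn) <-.
by rewrite sum1dep_card; apply: eq_card => H; rewrite !inE SU /= andbC.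
Qed.

Lemma card_rset (n r : nat) : #|@rset n r| = 'C(n, r).
Proof.
have := @card_draws 'I_n r; rewrite card_ord => <-.
by apply: eq_card => H; rewrite inE.
Qed.

(** The same double count with all [s]-sets as [U]; it identifies the chance that a random [r]-set
    contains a fixed [s]-set with the ratio p = m / N. *)
Lemma mul_bin_bin (n r s : nat) : (s <= r <= n)%N ->
  ('C(n, r) * 'C(r, s) = 'C(n, s) * 'C(n - s, r - s))%N.
Proof.
move=> h; have := @sum_subsets_covered n r s [set S : {set _} | #|S| == s] h.
rewrite card_draws card_ord => <-; last by move=> S; rewrite inE => /eqP.
rewrite (eq_bigr (fun=> 'C(r, s))).
  by rewrite sum_nat_const card_rset.
move=> H /eqP <-; rewrite -cards_draws; apply: eq_card => S.
by rewrite !inE andbC.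
Qed.

(** * Expectations over independent uniform draws *)

Lemma big_tuple_rcons (V : nmodType) (T : finType) (P : pred T) (k : nat)
    (F : seq T -> V) :
  \sum_(t : k.+1.-tuple T | all P t) F t =
  \sum_(t : k.-tuple T | all P t) \sum_(x | P x) F (rcons t x).
Proof.
rewrite pair_big /=.
rewrite (reindex_onto (fun u : k.-tuple T * T => [tuple of rcons u.1 u.2])
  (fun t => ([tuple of belast (thead t) (behead t)], last (thead t) (behead t)))) /=.
  apply: eq_bigl => -[t x] /=; rewrite all_rcons [RHS]andbC.
  case: (P x && all P t) => //=; apply/eqP.
  have e : t ++ [:: x] = rcons t x by rewrite cats1.
  case: t e => -[|y t] ht e //=; congr pair => //; try exact: val_inj.
  - by apply: val_inj => /=; rewrite /thead (tnth_nth y) /= belast_rcons.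
  - by rewrite last_rcons.
move=> t _; apply: val_inj => /=.
by rewrite -lastI [in RHS](tuple_eta t).
Qed.

(** [F] takes sequences rather than tuples, so that one function of the history can be averaged at
    every time [k]. *)
Definition mean (R : realType) (T : finType) (A : pred T) (k : nat)
    (F : seq T -> R) : R :=
  (\sum_(t : k.-tuple T | all A t) F t) / #|A|%:R ^+ k.
Arguments mean {R T} A k F.

Lemma mean0 (R : realType) (T : finType) (A : pred T) (F : seq T -> R) :
  mean A 0 F = F [::].
Proof.
rewrite /mean expr0 divr1 (big_pred1 [tuple]) // => t.
by rewrite tuple0 /=; apply/esym/eqP.
Qed.

(** Conditioning on the first [k] draws: the inner average runs over the last, independent draw. *)
Lemma meanS (R : realType) (T : finType) (A : pred T) (k : nat)
    (F : seq T -> R) :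
  mean A k.+1 F = mean A k (fun t => (\sum_(x | A x) F (rcons t x)) / #|A|%:R).
Proof.
by rewrite /mean big_tuple_rcons -mulr_suml exprS invfM mulrA.
Qed.

Lemma eq_mean (R : realType) (T : finType) (A : pred T) (k : nat)
    (F G : seq T -> R) :
  (forall t, size t = k -> F t = G t) -> mean A k F = mean A k G.
Proof.
move=> FG; rewrite /mean; congr (_ / _); apply: eq_bigr => t _.
by rewrite FG // size_tuple.
Qed.

Lemma mean_le (R : realType) (T : finType) (A : pred T) (k : nat)
    (F G : seq T -> R) :
  (forall t, F t <= G t) -> mean A k F <= mean A k G.
Proof.
move=> FG; apply: ler_wpM2r; first by rewrite invr_ge0 exprn_ge0.
by apply: ler_sum => t _.
Qed.

Lemma meanB (R : realType) (T : finType) (A : pred T) (k : nat)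
    (F G : seq T -> R) :
  mean A k (fun t => F t - G t) = mean A k F - mean A k G.
Proof. by rewrite /mean sumrB mulrBl. Qed.

Lemma meanZ (R : realType) (T : finType) (A : pred T) (k : nat) (c : R)
    (F : seq T -> R) :
  mean A k (fun t => c * F t) = c * mean A k F.
Proof. by rewrite /mean -mulr_sumr mulrA. Qed.

Lemma mean_cst (R : realType) (T : finType) (A : pred T) (k : nat) (c : R) :
  (0 < #|A|)%N -> mean A k (fun=> c) = c.
Proof.
move=> A0; elim: k => [|k IHk]; first by rewrite mean0.
rewrite meanS -[RHS]IHk; congr mean; apply/funext => t.
by rewrite sumr_const -[c *+ _]mulr_natr mulfK // pnatr_eq0 -lt0n.
Qed.

(** * The family of uncollected sets *)

Definition uncollected (n s : nat) (hs : seq {set 'I_n}) : {set {set 'I_n}} :=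
  [set S : {set 'I_n} |
    (#|S| == s) && ~~ has (fun H : {set 'I_n} => S \subset H) hs].
Arguments uncollected {n} s hs.

Lemma coversE (n s : nat) (hs : seq {set 'I_n}) :
  covers s hs = (#|uncollected s hs| == 0)%N.
Proof.
rewrite cards_eq0; apply/forallP/eqP => [h|h S].
  apply/finset.setP => S; rewrite !inE; move/implyP: (h S).
  by case: (#|S| == s) => //= ->.
have := finset.in_set0 S; rewrite -h inE.
by case: (#|S| == s) => //= /negbFE.
Qed.

Lemma card_uncollected_nil (n s : nat) :
  #|uncollected s ([::] : seq {set 'I_n})| = 'C(n, s).
Proof.
rewrite -[in RHS](card_ord n) -card_draws.
by apply: eq_card => S; rewrite !inE andbT.
Qed.

Lemma card_uncollected_le (n s : nat) (hs : seq {set 'I_n}) :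
  (#|uncollected s hs| <= 'C(n, s))%N.
Proof.
rewrite -card_uncollected_nil; apply/subset_leq_card/fintype.subsetP => S.
by rewrite !inE => /andP[->].
Qed.

Lemma card_uncollected_rcons (n s : nat) (hs : seq {set 'I_n}) (H : {set 'I_n}) :
  #|uncollected s (rcons hs H)| =
  (#|uncollected s hs| - #|[set S in uncollected s hs | S \subset H]|)%N.
Proof.
rewrite -cardsDS; last by apply/fintype.subsetP => S; rewrite inE => /andP[].
apply: eq_card => S; rewrite !inE has_rcons negb_or.
by case: (#|S| == s); case: (S \subset H); case: has.
Qed.

Lemma card_newly_collected (n s : nat) (hs : seq {set 'I_n}) (H : {set 'I_n}) :
  (#|[set S in uncollected s hs | S \subset H]| <= 'C(#|H|, s))%N.
Proof.
rewrite -cards_draws; apply/subset_leq_card/fintype.subsetP => S.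
by rewrite !inE => /andP[/andP[-> _] ->].
Qed.

(* P(T > k) *)
Definition tail (R : realType) (n r s k : nat) : R :=
  mean (@rset n r) k (fun hs => (~~ covers s hs)%:R).

(** * Drift of a potential of the uncollected count *)

Lemma tail_ge0 (R : realType) (n r s k : nat) : 0 <= tail R n r s k.
Proof. by apply: divr_ge0; rewrite ?exprn_ge0 // sumr_ge0. Qed.

(* Used with c = 1 for an upper bound on the drop of phi, and with c = -1 on an
   opposite potential for a lower bound. *)
Lemma drift (R : realType) (n r s k : nat) (phi : nat -> R) (c : R) :
  (s <= r <= n)%N ->
  (forall u d, (0 < u)%N -> (d <= u)%N -> (d <= 'C(r, s))%N ->
    phi u - phi (u - d)%N <= c * (d%:R / u%:R)) ->
  mean (@rset n r) k (fun hs => phi #|uncollected s hs|) -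
  mean (@rset n r) k.+1 (fun hs => phi #|uncollected s hs|) <=
  c * ('C(r, s)%:R / 'C(n, s)%:R) * tail R n r s k.
Proof.
move=> hsrn hphi; have /andP[hsr hrn] := hsrn.
have Cn0 : ('C(n, r)%:R : R) != 0 by rewrite pnatr_eq0 -lt0n bin_gt0.
have Cs0 : ('C(n, s)%:R : R) != 0.
  by rewrite pnatr_eq0 -lt0n bin_gt0 (leq_trans hsr).
rewrite meanS -meanB -meanZ; apply: mean_le => hs.
set U := uncollected s hs.
rewrite card_rset coversE -/U.
have -> : phi #|U| - (\sum_(H | rset r H) phi #|uncollected s (rcons hs H)|)
      / 'C(n, r)%:R =
    (\sum_(H : {set 'I_n} | rset r H)
      (phi #|U| - phi (#|U| - #|[set S in U | S \subset H]|)%N)) / 'C(n, r)%:R.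
  rewrite sumrB sumr_const card_rset -[phi _ *+ _]mulr_natr mulrBl mulfK //.
  by under [in LHS]eq_bigr do rewrite card_uncollected_rcons.
(* Once everything is collected the potential no longer moves, and the indicator inside [tail]
   vanishes as well. *)
have [U0|U0] := posnP #|U|.
  by rewrite U0 mulr0 big1 ?mul0r // => H _; rewrite sub0n subrr.
rewrite mulr1 ler_pdivrMr ?lt0r ?Cn0 ?ler0n //.
apply: (@le_trans _ _ (\sum_(H : {set 'I_n} | rset r H)
    c * (#|[set S in U | S \subset H]|%:R / #|U|%:R))).
  apply: ler_sum => H /eqP cH; apply: hphi => //.
    by apply/subset_leq_card/fintype.subsetP => S; rewrite inE => /andP[].
  by rewrite -cH card_newly_collected.
(* The double count gives [#|U| * 'C(n - s, r - s)], so the division by [#|U|] leaves a bound that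
   does not depend on the history. *)
rewrite -mulr_sumr -mulr_suml -natr_sum (sum_subsets_covered n r s) //; last first.
  by move=> S; rewrite inE => /andP[/eqP].
rewrite natrM mulrAC mulfV ?mul1r; last by rewrite pnatr_eq0 -lt0n.
rewrite -mulrA mulrAC -natrM mulnC mul_bin_bin // natrM mulrAC mulfV //.
by rewrite mul1r.
Qed.

Lemma drift_sum (R : realType) (n r s k : nat) (phi : nat -> R) (c : R) :
  (s <= r <= n)%N ->
  (forall u d, (0 < u)%N -> (d <= u)%N -> (d <= 'C(r, s))%N ->
    phi u - phi (u - d)%N <= c * (d%:R / u%:R)) ->
  phi 'C(n, s) - mean (@rset n r) k (fun hs => phi #|uncollected s hs|) <=
  c * ('C(r, s)%:R / 'C(n, s)%:R) * \sum_(j < k) tail R n r s j.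
Proof.
move=> hsrn hphi; elim: k => [|k IHk].
  by rewrite mean0 card_uncollected_nil subrr big_ord0 mulr0.
rewrite big_ord_recr mulrDr /=; have := drift R n r s k phi c hsrn hphi.
lra.
Qed.

(** * The two logarithmic potentials *)

(** With w = u - d, the quotient of the arguments is 1 + d / (m + w). Then ln (1 + x) <= x applies,
    and u <= m + w because d <= m. *)
Lemma log_shift_drop (R : realType) (m u d : nat) :
  (0 < u)%N -> (d <= u)%N -> (d <= m)%N ->
  ln (1 + u%:R / m%:R : R) - ln (1 + (u - d)%N%:R / m%:R : R) <=
  1 * (d%:R / u%:R).
Proof.
move=> u0 du dm; case: (posnP m) => [m0|m0].
  by move: dm; rewrite m0 leqn0 => /eqP ->; rewrite !subn0 subrr mul0r mulr0.
have m0' : (0 : R) < m%:R by rewrite ltr0n.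
have u0' : (0 : R) < u%:R by rewrite ltr0n.
have pos (v : nat) : (0 : R) < 1 + v%:R / m%:R.
  by rewrite ltr_pwDl // divr_ge0.
rewrite -ln_div ?posrE //.
set w := (u - d)%N.
have wE : (u%:R : R) = w%:R + d%:R by rewrite -natrD subnK.
have wm : (u%:R : R) <= m%:R + w%:R by rewrite -natrD ler_nat; lia.
have wm0 : (0 : R) < m%:R + w%:R by rewrite (lt_le_trans u0').
have -> : (1 + u%:R / m%:R) / (1 + w%:R / m%:R) =
    1 + d%:R / (m%:R + w%:R) :> R.
  by rewrite wE; field; rewrite !gt_eqF.
rewrite mul1r; apply: (le_trans (le_ln1Dx _)).
  by rewrite (@lt_le_trans _ _ 0) ?ltrN10 // divr_ge0 // ltW.
by rewrite ler_wpM2l // lef_pV2 ?posrE.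
Qed.

(** For u - d > 0 this is ln (1 + x) <= x at x = - d / u. For d = u the jump of 1 at zero pays for d
    / u = 1. *)
Lemma log_drop (R : realType) (u d : nat) :
  (0 < u)%N -> (d <= u)%N ->
  (d%:R / u%:R : R) <= 1 + ln u%:R -
    (if (u - d == 0)%N then 0 else 1 + ln (u - d)%N%:R).
Proof.
move=> u0 du; case: ifPn => [/eqP w0|w0].
  have -> : d = u by lia.
  rewrite divff ?pnatr_eq0 ?lt0n_neq0 // subr0 lerDl ln_ge0 //.
  by rewrite ler1n.
rewrite -lt0n in w0; set w := (u - d)%N in w0 *.
have u0' : (0 : R) < u%:R by rewrite ltr0n.
have w0' : (0 : R) < w%:R by rewrite ltr0n.
have wE : (u%:R : R) = w%:R + d%:R by rewrite -natrD subnK.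
have := @le_ln1Dx R (- (d%:R / u%:R)).
have -> : 1 + - (d%:R / u%:R) = w%:R / u%:R :> R.
  by rewrite wE; field; rewrite -wE gt_eqF.
rewrite ln_div ?posrE // => /(_ _) H.
suff : ln w%:R - ln u%:R <= - (d%:R / u%:R) :> R by lra.
apply: H; rewrite ltrN2 ltr_pdivrMr // mul1r ltr_nat; lia.
Qed.

(** * Bounds on the partial sums of P(T > j) *)

Lemma tail_sum_le (R : realType) (n r s k : nat) : (s <= r <= n)%N ->
  'C(r, s)%:R / 'C(n, s)%:R * \sum_(j < k) tail R n r s j <=
  1 + ln ('C(n, s)%:R : R).
Proof.
move=> hsrn; have /andP[hsr hrn] := hsrn.
(* The value at 0 is set apart because [ln 0] is 0 by convention, so that [1 + ln u%:R] would be 1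
   there. *)
pose psi (u : nat) : R := if (u == 0)%N then 0 else 1 + ln u%:R.
have psi0 u : 0 <= psi u.
  rewrite /psi; case: eqP => // /eqP u0.
  by rewrite addr_ge0 // ln_ge0 // ler1n lt0n.
have : - psi 'C(n, s) - mean (@rset n r) k (fun hs => - psi #|uncollected s hs|)
    <= -1 * ('C(r, s)%:R / 'C(n, s)%:R) * \sum_(j < k) tail R n r s j.
  apply: (drift_sum R n r s k (fun u => - psi u)) => // u d u0 du _.
  have := @log_drop R u d u0 du.
  by rewrite /psi [(u == 0)%N]gtn_eqF //; lra.
have -> : mean (@rset n r) k (fun hs => - psi #|uncollected s hs|) =
   - mean (@rset n r) k (fun hs => psi #|uncollected s hs|).
  rewrite -mulN1r -meanZ; congr mean.
  by apply/funext => hs; rewrite mulN1r.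
have : 0 <= mean (@rset n r) k (fun hs => psi #|uncollected s hs|).
  by apply: divr_ge0; rewrite ?exprn_ge0 // sumr_ge0.
have -> : psi 'C(n, s) = 1 + ln 'C(n, s)%:R.
  by rewrite /psi gtn_eqF // bin_gt0 (leq_trans hsr).
lra.
Qed.

(** The potential vanishes at 0 and is at most its initial value elsewhere, so its mean at time [k]
    is at most that value times P(T > k); this is the source of the factor [1 - tail R n r s k]. *)
Lemma tail_sum_ge (R : realType) (n r s k : nat) : (s <= r <= n)%N ->
  ln (1 + 'C(n, s)%:R / 'C(r, s)%:R : R) * (1 - tail R n r s k) <=
  'C(r, s)%:R / 'C(n, s)%:R * \sum_(j < k) tail R n r s j.
Proof.
move=> hsrn.
pose phi (u : nat) : R := ln (1 + u%:R / 'C(r, s)%:R).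
have := @drift_sum R n r s k phi 1 hsrn (@log_shift_drop R _).
rewrite mul1r; apply: le_trans; rewrite mulrBr mulr1 lerD2l lerN2.
rewrite -meanZ; apply: mean_le => hs; rewrite coversE.
case: eqP => [->|_] /=; first by rewrite /phi mul0r addr0 ln1 mulr0.
rewrite mulr1 ler_ln ?posrE ?ltr_pwDl ?divr_ge0 //.
by rewrite lerD2l ler_wpM2r ?invr_ge0 // ler_nat card_uncollected_le.
Qed.

(** * From tails to the law and expectation of T *)

Lemma covers_rcons (n s : nat) (hs : seq {set 'I_n}) (H : {set 'I_n}) :
  covers s hs -> covers s (rcons hs H).
Proof. by rewrite !coversE card_uncollected_rcons => /eqP ->; rewrite sub0n. Qed.

Lemma PTS (R : realType) (n r s k : nat) : (r <= n)%N ->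
  PT R n r s k.+1 = tail R n r s k - tail R n r s k.+1.
Proof.
move=> hrn.
have A0 : (0 < #|@rset n r|)%N by rewrite card_rset bin_gt0.
have -> : PT R n r s k.+1 = mean (@rset n r) k.+1 (fun hs => (T_eq s k.+1 hs)%:R).
  have den : (#|[set hs : k.+1.-tuple {set 'I_n} | all (@rset n r) hs]|%:R : R)
     = #|@rset n r|%:R ^+ k.+1.
    have := @mean_cst R _ (@rset n r) k.+1 1 A0.
    by rewrite /mean sumr_const -cardsE => /divr1_eq.
  rewrite /PT den /mean; congr (_ / _).
  rewrite -sum1_card natr_sum big_mkcond [RHS]big_mkcond /=.
  by apply: eq_bigr => hs _; rewrite inE; case: all => //=; case: T_eq.
rewrite /tail 2!meanS -meanB; apply: eq_mean => hs hk.
(* The indicator at time [k] is averaged over a dummy last draw, so that both sides can be compared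
   draw by draw. *)
have -> : (~~ covers s hs)%:R =
    (\sum_(H | @rset n r H) (~~ covers s hs)%:R) / #|@rset n r|%:R :> R.
  by rewrite sumr_const -[_ *+ #|_|]mulr_natr mulfK // pnatr_eq0 -lt0n.
rewrite -mulrBl -sumrB; congr (_ / _); apply: eq_bigr => H _.
rewrite /T_eq take_oversize ?size_rcons ?hk //= -hk -cats1 take_size_cat // cats1.
have := @covers_rcons n s hs H.
by case: covers => [->//|_]; rewrite ?subrr //; case: covers; rewrite ?subr0 ?subrr.
Qed.

Lemma PT_ge0 (R : realType) (n r s k : nat) : 0 <= PT R n r s k.
Proof. by apply: divr_ge0. Qed.

Lemma tail_nonincreasing (R : realType) (n r s j k : nat) :
  (r <= n)%N -> (j <= k)%N -> tail R n r s k <= tail R n r s j.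
Proof.
move=> hrn /subnK <-; elim: (k - j)%N => // i IH.
by rewrite (le_trans _ IH) // addSn -subr_ge0 -PTS // PT_ge0.
Qed.

(** Summation by parts, with a boundary term at [k]. *)
Lemma sum_PT (R : realType) (n r s k : nat) : (r <= n)%N ->
  \sum_(0 <= j < k.+1) j%:R * PT R n r s j =
  \sum_(j < k) tail R n r s j - k%:R * tail R n r s k.
Proof.
move=> hrn; elim: k => [|k IHk].
  by rewrite big_nat1 big_ord0 !mul0r subr0.
rewrite big_nat_recr //= IHk big_ord_recr /= PTS // -natr1; ring.
Qed.

(** The left side is E[min(T, l); T <= k]: weights [j] above [l] are lowered to [l]. With [l] fixed,
    the correction vanishes as [k] grows. *)
Lemma sum_PT_ge (R : realType) (n r s l k : nat) : (r <= n)%N -> (l <= k)%N ->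
  \sum_(j < l) tail R n r s j - l%:R * tail R n r s k <=
  \sum_(0 <= j < k.+1) j%:R * PT R n r s j.
Proof.
move=> hrn /subnK <-; elim: (k - l)%N => [|i IH]; first by rewrite sum_PT.
rewrite addSn big_nat_recr //=; apply: (le_trans _ (lerD IH (lexx _))).
have := PT_ge0 R n r s (i + l).+1; rewrite PTS //.
move: (tail _ _ _ _ _) (tail _ _ _ _ (i + l).+1) => a b ab.
have : (l%:R : R) * (a - b) <= (i + l).+1%:R * (a - b).
  by rewrite ler_wpM2r // ler_nat; lia.
lra.
Qed.

(** Tails do not increase, so k P(T > k) is at most the sum of the first [k] tails, which is bounded
    uniformly in [k]. *)
Lemma tail_small (R : realType) (n r s l : nat) (e : R) :
  (s <= r <= n)%N -> 0 < e -> exists2 k, (l <= k)%N & tail R n r s k <= e.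
Proof.
move=> hsrn e0; have /andP[hsr hrn] := hsrn.
set p : R := 'C(r, s)%:R / 'C(n, s)%:R.
have p0 : 0 < p by rewrite divr_gt0 // ltr0n bin_gt0 // (leq_trans hsr).
(* Beyond [c], a tail larger than [e] would push the sum of tails above its bound (1 + ln N) / p. *)
pose c : R := (1 + ln 'C(n, s)%:R) / p / e.
pose k := maxn l (Num.bound `|c|).
exists k; first exact: leq_maxl.
have k_sum : k%:R * tail R n r s k <= \sum_(j < k) tail R n r s j.
  apply: (@le_trans _ _ (\sum_(j < k) tail R n r s k)).
    by rewrite sumr_const card_ord mulr_natl.
  by apply: ler_sum => j _; rewrite tail_nonincreasing // ltnW.
have := @tail_sum_le R n r s k hsrn; rewrite -/p => h.
have ck : c < k%:R.
  apply/(le_lt_trans (ler_norm c))/(lt_le_trans (archi_boundP (normr_ge0 c))).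
  by rewrite ler_nat leq_maxr.
rewrite leNgt; apply/negP => et.
have : (1 + ln 'C(n, s)%:R) / p < k%:R * e by rewrite -ltr_pdivrMr.
rewrite ltr_pdivrMr // => h2.
have : k%:R * e * p <= k%:R * tail R n r s k * p.
  by rewrite ler_wpM2r ?(ltW p0) // ler_wpM2l // ltW.
have : k%:R * tail R n r s k * p <= p * \sum_(j < k) tail R n r s j.
  by rewrite mulrC ler_wpM2l // ltW.
lra.
Qed.

Lemma ET_bounds (R : realType) (n r s : nat) : (s <= r <= n)%N ->
  exists2 E : R, ET R n r s = E%:E &
    ln (1 + 'C(n, s)%:R / 'C(r, s)%:R) <= 'C(r, s)%:R / 'C(n, s)%:R * E
      <= 1 + ln 'C(n, s)%:R.
Proof.
move=> hsrn; have /andP[hsr hrn] := hsrn.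
set p : R := 'C(r, s)%:R / 'C(n, s)%:R.
have p0 : 0 < p by rewrite divr_gt0 // ltr0n bin_gt0 // (leq_trans hsr).
have term0 k : (0 <= (k%:R * PT R n r s k)%:E)%E.
  by rewrite lee_fin mulr_ge0 // PT_ge0.
have le_ET k : ((\sum_(0 <= j < k.+1) j%:R * PT R n r s j)%:E <= ET R n r s)%E.
  rewrite -sumEFin; exact: nneseries_lim_ge.
have ET_le : (ET R n r s <= ((1 + ln 'C(n, s)%:R) / p)%:E)%E.
  apply: lime_le; first exact: is_cvg_nneseries.
  apply: nearW => k; rewrite sumEFin lee_fin.
  (* Partial sums of the series stop before [k]; the term at [k] is added to match [sum_PT]. *)
  apply: (@le_trans _ _ (\sum_(0 <= j < k.+1) j%:R * PT R n r s j)).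
    by rewrite big_nat_recr //= lerDl mulr_ge0 // PT_ge0.
  rewrite sum_PT // ler_pdivlMr // mulrC.
  apply: le_trans (@tail_sum_le R n r s k hsrn); rewrite -/p ler_wpM2l ?(ltW p0) //.
  by rewrite gerDl oppr_le0 mulr_ge0 // tail_ge0.
have ET_fin : ET R n r s \is a fin_num.
  rewrite ge0_fin_numE ?(le_lt_trans ET_le) ?ltry //.
  by apply: nneseries_ge0 => k _ _; exact: term0.
exists (fine (ET R n r s)); first by rewrite fineK.
move: le_ET ET_le; rewrite -(fineK ET_fin) lee_fin.
move: (fine _) => E /= le_E; rewrite ler_pdivlMr // mulrC => ->; rewrite andbT.
set phi := ln (1 + _).
have phi0 : 0 <= phi.
  by rewrite ln_ge0 // lerDl divr_ge0.
apply/ler_addgt0Pr => e e0.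
have phi1 : 0 < phi + 1 by rewrite ltr_wpDl.
(* First [l] makes the loss in [tail_sum_ge] at most e / 2, then [k >= l] does the same for the
   truncation loss of [sum_PT_ge]. The added 1 keeps both denominators positive. *)
have [|l _ ql] := @tail_small R n r s 0 (e / 2 / (phi + 1)) hsrn.
  by rewrite !divr_gt0.
have [|k lk qk] := @tail_small R n r s l (e / 2 / (p * l%:R + 1)) hsrn.
  by rewrite !divr_gt0 // ltr_wpDl // mulr_ge0 // ltW.
have := @tail_sum_ge R n r s l hsrn; rewrite -/p -/phi => h1.
have := le_E k; rewrite lee_fin => /(le_trans (@sum_PT_ge R n r s l k hrn lk)).
rewrite -(ler_pM2l p0) mulrBr => h2.
have : phi * tail R n r s l <= e / 2.
  move: ql; rewrite ler_pdivlMr // mulrC; apply: le_trans.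
  by rewrite ler_wpM2r ?tail_ge0 // lerDl.
have : p * (l%:R * tail R n r s k) <= e / 2.
  move: qk; rewrite ler_pdivlMr ?ltr_wpDl ?mulr_ge0 ?(ltW p0) // mulrC.
  apply: le_trans; rewrite mulrA ler_wpM2r ?tail_ge0 // lerDl //.
rewrite mulrBr mulr1 in h1.
lra.
Qed.

(** * Asymptotics in [n] *)

(** Induction on [n - s] by Pascal's rule; a linear lower bound is enough to send ln N to
    infinity. *)
Lemma bin_ge (n s : nat) : (0 < s <= n)%N -> (n - s < 'C(n, s))%N.
Proof.
case/andP=> s0 /subnK <-; rewrite addnK.
elim: (n - s)%N => [|j IH]; first by rewrite binn.
case: s s0 IH => // s _ IH; rewrite addSn addnS binS -addnS.
have : (0 < 'C((j + s).+1, s))%N by rewrite bin_gt0 leqW // leq_addl.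
by move: IH; rewrite addnS; lia.
Qed.

Local Open Scope classical_set_scope.
Local Open Scope ring_scope.

Lemma ln_bin_cvg_pinfty (R : realType) (s : nat) : (0 < s)%N ->
  (fun n : nat => ln ('C(n, s)%:R : R)) @ \oo --> +oo%R.
Proof.
move=> s0; apply/cvgryPge => A; near=> n.
have sn : (s <= n)%N by near: n; exact: nbhs_infty_ge.
rewrite -[leLHS]expRK ler_ln ?posrE ?expR_gt0 ?ltr0n ?bin_gt0 //.
have hn : expR A + s%:R <= n%:R by near: n; exact: nbhs_infty_ger.
have := @bin_ge n s; rewrite s0 sn => /(_ isT) h.
have : (n%:R : R) <= 'C(n, s)%:R + s%:R by rewrite -natrD ler_nat; lia.
lra.
Unshelve. all: by end_near. Qed.

Theorem theorem1 (R : realType) (r s : nat) (hs1 : (1 <= s)%N) (hsr : (s <= r)%N) :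
  (\forall n \near \oo, ET R n r s \is a fin_num) /\
  ((fun n : nat => fine (ET R n r s) / mainterm R n r s) @ \oo --> (1 : R)).
Proof.
split.
  near=> n; have hrn : (r <= n)%N by near: n; exact: nbhs_infty_ge.
  by have [|E ->] := @ET_bounds R n r s; rewrite ?hsr ?hrn.
have lnV0 : (fun n : nat => (ln ('C(n, s)%:R : R))^-1) @ \oo --> (0 : R).
  apply/gtr0_cvgV0; last exact: ln_bin_cvg_pinfty.
  exact: (cvgry_gt (@ln_bin_cvg_pinfty R s hs1)).
(* These are the bounds on p E[T] divided by ln N, the lower one weakened through ln (1 + N / m) >=
   ln N - ln m. *)
apply: (@squeeze_cvgr _ _ _ _
  (fun n : nat => 1 - ln ('C(r, s)%:R : R) * (ln ('C(n, s)%:R : R))^-1)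
  (fun n : nat => 1 + (ln ('C(n, s)%:R : R))^-1)); last 2 first.
- rewrite -[X in _ --> X]subr0 -[X in _ - X](mulr0 (ln ('C(r, s)%:R : R))).
  by apply: cvgB; [exact: cvg_cst | apply: cvgM => //; exact: cvg_cst].
- by rewrite -[X in _ --> X]addr0; apply: cvgD => //; exact: cvg_cst.
near=> n.
have hrn : (r <= n)%N by near: n; exact: nbhs_infty_ge.
have hsn := leq_trans hsr hrn.
have lnN : 0 < ln ('C(n, s)%:R : R).
  near: n; exact: (cvgry_gt (@ln_bin_cvg_pinfty R s hs1)).
have [|E -> /andP[lo up]] := @ET_bounds R n r s; first by rewrite hsr hrn.
have N0 : (0 : R) < 'C(n, s)%:R by rewrite ltr0n bin_gt0.
have M0 : (0 : R) < 'C(r, s)%:R by rewrite ltr0n bin_gt0.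
have -> : fine E%:E / mainterm R n r s =
    'C(r, s)%:R / 'C(n, s)%:R * E / ln ('C(n, s)%:R : R).
  by rewrite /mainterm /=; field; rewrite !gt_eqF.
apply/andP; split.
  rewrite ler_pdivlMr // mulrBl mul1r divfK ?gt_eqF //.
  apply: le_trans lo; rewrite -ln_div ?posrE //.
  by rewrite ler_ln ?posrE ?ltr_pwDl ?divr_ge0 ?divr_gt0 ?lerDr // ltW.
by rewrite ler_pdivrMr // mulrDl mul1r mulVf ?gt_eqF // addrC.
Unshelve. all: by end_near. Qed.
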